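(* Let $m \ge 2$ and $\lambda \ge 1$ be integers. Suppose $S_1,S_2,\dots,S_t$ is a set of mutually orthogonal frequency squares (MOFS) of type $F(m\lambda;\lambda)$. Relabel the symbols of each F-square if necessary (that is, apply a permutation of $\{1,2,\dots,m\}$ to the entries of $S_k$, chosen separately for each $k$) so that the $(1,1)$ entry satisfies $(S_k)_{11}=1$ for each $k\in\{1,2,\dots,t\}$. Then $$t \le \frac{(m\lambda-1)^2}{m-1},$$ and equality holds if and only if $$\sum_{k=1}^t\sum_{a=2}^m I_a(S_k) = \begin{bmatrix} 0 &\lambda(m\lambda-1) & \dots & \lambda(m\lambda-1) \\ \lambda(m\lambda-1) & \lambda(m\lambda-2) & \dots &\lambda(m\lambda-2) \\ \vdots & \vdots & \ddots & \vdots \\ \lambda(m\lambda-1) &\lambda(m\lambda-2) & \dots &\lambda(m\lambda-2) \end{bmatrix},$$ where the right-hand side is the $m\lambda\times m\lambda$ array whose $(1,1)$ entry is $0$, whose remaining entries in the first row and in the first column all equal $\lambda(m\lambda-1)$, and whose entries $(i,j)$ with $i,j>1$ all equal $\lambda(m\lambda-2)$.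
   Context: A frequency square (F-square) of type $F(m\lambda;\lambda)$ is an $m\lambda\times m\lambda$ array with entries in the symbol set $\{1,2,\dots,m\}$ such that each symbol appears exactly $\lambda$ times in each row and exactly $\lambda$ times in each column. Two F-squares $S$ and $S'$ of type $F(m\lambda;\lambda)$ are orthogonal if each ordered pair of symbols $(j,j')\in\{1,\dots,m\}^2$ appears exactly $\lambda^2$ times in the superposition of $S$ on $S'$, i.e. there are exactly $\lambda^2$ positions at which $S$ has entry $j$ and $S'$ has entry $j'$. A set of mutually orthogonal frequency squares (MOFS) of type $F(m\lambda;\lambda)$ is a set of pairwise orthogonal F-squares of that type. For an F-square $S=(S_{ij})$ of type $F(m\lambda;\lambda)$ and $a\in\{1,\dots,m\}$, the indicator square $I_a(S)$ is the $m\lambda\times m\lambda$ array with entries in $\{0,1\}$ (treated as integers) whose $(i,j)$ entry is $1$ if $S_{ij}=a$ and $0$ otherwise. *)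

(* Defs.v *)
From mathcomp Require Import all_boot all_order all_algebra all_fingroup.

Set Implicit Arguments.
Unset Strict Implicit.
Unset Printing Implicit Defensive.

Import GRing.Theory.
Local Open Scope ring_scope.

(* Arrays of side m * l with entries in the symbol set {1, ..., m}.  Symbols
   and positions are numbered from 0: symbol a is the ordinal of value a - 1,
   so that symbol 1 has value 0, and position (1, 1) is (0, 0). *)
Definition square (m l : nat) := 'M['I_m]_(m * l).

Definition is_Fsquare (m l : nat) (S : square m l) : Prop :=
  (forall i (a : 'I_m), #|[set j | S i j == a]| = l) /\
  (forall j (a : 'I_m), #|[set i | S i j == a]| = l).

Definition orthogonal (m l : nat) (S S' : square m l) : Prop :=
  forall a a' : 'I_m,
    #|[set p : 'I_(m * l) * 'I_(m * l) |
        (S p.1 p.2 == a) && (S' p.1 p.2 == a')]| = (l ^ 2)%N.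

(* For 1 < m and 0 < l an F-square is never orthogonal to itself, so the
   members of such a family are pairwise distinct. *)
Definition is_MOFS (m l t : nat) (S : 'I_t -> square m l) : Prop :=
  (forall k, is_Fsquare (S k)) /\
  (forall k k', k != k' -> orthogonal (S k) (S k')).

Definition relabel (m l : nat) (s : 'S_m) (S : square m l) : square m l :=
  map_mx s S.

(* Quantifying over the indices of value 0 avoids a proof that 0 < m * l; when
   0 < m * l there is exactly one such position. *)
Definition corner_is_1 (m l : nat) (S : square m l) : Prop :=
  forall i j : 'I_(m * l),
    i = 0%N :> nat -> j = 0%N :> nat -> S i j = 0%N :> nat.

Definition indicator (m l : nat) (a : 'I_m) (S : square m l)
    : 'M[int]_(m * l) :=
  \matrix_(i, j) (if S i j == a then 1 else 0).

Definition extremal_mx (m l : nat) : 'M[int]_(m * l) :=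
  \matrix_(i, j)
    if (i == 0%N :> nat) && (j == 0%N :> nat) then 0
    else if (i == 0%N :> nat) || (j == 0%N :> nat)
    then l%:Z * ((m * l)%:Z - 1)
    else l%:Z * ((m * l)%:Z - 2).

(* Main.v *)
Require Import Defs.
From mathcomp Require Import all_boot all_order all_algebra all_fingroup.
From mathcomp Require Import ring lra.

Set Implicit Arguments.
Unset Strict Implicit.
Unset Printing Implicit Defensive.

Import Order.TTheory Num.Theory.
Import GRing.Theory.
Local Open Scope ring_scope.

(** Write [n = m * l].  In the Euclidean space of [n * n] arrays let [X] be
    [n ^ 2] times the projection of the unit array at the corner onto the arrays
    with zero row and column sums, and let [Y_k] be [n ^ 2] times its projection
    onto the subspace of those arrays that are constant on each symbol class of
    [S_k].  Then [Y_k = m I_a - J], where [a] is the corner symbol of [S_k] and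
    [J] is the all-ones array.  Orthogonality of the squares makes the [Y_k]
    orthogonal, and Bessel's inequality takes the exact form
    [|X - \sum_k Y_k| ^ 2 = n ^ 2 * ((n - 1) ^ 2 - t * (m - 1))].  So equality
    in the bound means [X = \sum_k Y_k], which determines the sum of the
    indicator squares.  Conversely, the first row of the extremal array has sum
    [l * (n - 1) ^ 2], and that of the indicator sum is [t * (n - l)]; equating
    the two gives [t * (m - 1) = (n - 1) ^ 2]. *)

Lemma sum_natr_card (T : finType) (P : pred T) :
  \sum_x (P x)%:R = #|[set x | P x]|%:R :> int.
Proof.
rewrite -natr_sum; congr (_%:R).
by rewrite -sum1_card [RHS]big_mkcond; apply: eq_bigr => x _; rewrite inE; case: (P x).
Qed.

Section Deviation.
Variables m l : nat.
Implicit Types S : square m l.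

(** Scaling the centred indicator by [m] keeps it integral. *)
Definition dev S (a : 'I_m) i j : int := m%:R * (S i j == a)%:R - 1.

Lemma sum_dev_row S a i : is_Fsquare S -> \sum_j dev S a i j = 0.
Proof.
case=> hr _; rewrite sumrB -mulr_sumr sum_natr_card hr sumr_const card_ord.
by rewrite -natrM subrr.
Qed.

Lemma sum_dev_col S a j : is_Fsquare S -> \sum_i dev S a i j = 0.
Proof.
case=> _ hc; rewrite sumrB -mulr_sumr sum_natr_card hc sumr_const card_ord.
by rewrite -natrM subrr.
Qed.

Lemma sum_dev S a : is_Fsquare S -> \sum_p dev S a p.1 p.2 = 0.
Proof.
by move=> hS; rewrite -(pair_bigA _ (dev S a)) big1 // => i _; exact: sum_dev_row.
Qed.

Lemma sum_indic S a : is_Fsquare S ->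
  \sum_p (S p.1 p.2 == a)%:R = (m * l)%:R * l%:R :> int.
Proof.
case=> hr _; rewrite -(pair_bigA _ (fun i j => (S i j == a)%:R : int)) /=.
under eq_bigr => i _ do rewrite sum_natr_card hr.
by rewrite sumr_const card_ord [RHS]mulr_natl.
Qed.

Lemma dev_orthogonal S S' a a' : is_Fsquare S -> is_Fsquare S' ->
  Defs.orthogonal S S' -> \sum_p dev S a p.1 p.2 * dev S' a' p.1 p.2 = 0.
Proof.
move=> hS hS' hO.
(* The joint indicator sums to [l ^ 2] and the last term to 0, which leaves
   [m^2 l^2 - m (m l) l = 0]. *)
have E p : dev S a p.1 p.2 * dev S' a' p.1 p.2 =
    m%:R ^+ 2 * ((S p.1 p.2 == a) && (S' p.1 p.2 == a'))%:R
    - m%:R * (S p.1 p.2 == a)%:R - dev S' a' p.1 p.2.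
  by rewrite /dev; do 2 case: eqP => _ /=; ring.
under eq_bigr => p _ do rewrite E.
rewrite 2!sumrB sum_dev // -!mulr_sumr sum_natr_card hO sum_indic //.
by rewrite natrX natrM; ring.
Qed.

Lemma dev_norm S a : is_Fsquare S ->
  \sum_p dev S a p.1 p.2 ^+ 2 = (m * l)%:R ^+ 2 * (m%:R - 1).
Proof.
move=> hS.
(* An indicator is idempotent, so the square is affine in [dev] and only its constant part survives
   summation. *)
have E p : dev S a p.1 p.2 ^+ 2 = (m%:R - 2) * dev S a p.1 p.2 + (m%:R - 1).
  by rewrite /dev; case: eqP => _ /=; ring.
under eq_bigr => p _ do rewrite E.
rewrite big_split /= -mulr_sumr sum_dev // mulr0 add0r sumr_const.
by rewrite card_prod card_ord -[LHS]mulr_natl mulnn natrX.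
Qed.

End Deviation.

(** This is [n] times the projection of the unit vector at [i0] onto the vectors with zero sum. *)
Definition centred (n : nat) (i0 i : 'I_n) : int := n%:R * (i == i0)%:R - 1.

Lemma sum_centredM n (i0 : 'I_n) (f : 'I_n -> int) :
  \sum_i centred i0 i * f i = n%:R * f i0 - \sum_i f i.
Proof.
under eq_bigr => i _ do rewrite mulrBl mul1r.
rewrite sumrB; congr (_ - _); rewrite (bigD1 i0) //= eqxx mulr1 big1 ?addr0 //.
by move=> i /negbTE->; rewrite mulr0 mul0r.
Qed.

Section Corner.
Variables (m l t : nat) (S : 'I_t -> square m l) (i0 : 'I_(m * l)).
Hypothesis hS : is_MOFS S.

Let n : int := (m * l)%:R.
Let X (p : 'I_(m * l) * 'I_(m * l)) := centred i0 p.1 * centred i0 p.2.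
Let Y k (p : 'I_(m * l) * 'I_(m * l)) := dev (S k) (S k i0 i0) p.1 p.2.

Lemma corner_norm : \sum_p X p ^+ 2 = n ^+ 2 * (n - 1) ^+ 2.
Proof.
have E : \sum_i centred i0 i ^+ 2 = n * (n - 1).
  rewrite sum_centredM sumrB -mulr_sumr sum_natr_card.
  have -> : [set i | i == i0] = [set i0] by apply/setP => i; rewrite !inE.
  by rewrite cards1 sumr_const card_ord /centred eqxx -/n /=; ring.
under eq_bigr => p _ do rewrite exprMn.
rewrite -(pair_bigA _ (fun i j => centred i0 i ^+ 2 * centred i0 j ^+ 2)) /=.
by rewrite -big_distrlr /= E; ring.
Qed.

(** Rows and columns of [Y k] sum to zero, so pairing with [X] reads off [n ^ 2] times the entry at
    the corner, which is [m - 1]. *)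
Lemma corner_dev k : \sum_p X p * Y k p = n ^+ 2 * (m%:R - 1).
Proof.
have [hF _] := hS.
rewrite -(pair_bigA _ (fun i j => X (i, j) * Y k (i, j))) /=.
have row i : \sum_j X (i, j) * Y k (i, j) =
    centred i0 i * (n * dev (S k) (S k i0 i0) i i0).
  under eq_bigr => j _ do rewrite /X /Y /= -mulrA.
  by rewrite -mulr_sumr sum_centredM sum_dev_row // subr0.
under eq_bigr => i _ do rewrite row.
rewrite sum_centredM -mulr_sumr sum_dev_col // mulr0 subr0 /dev /centred !eqxx -/n /=.
ring.
Qed.

(** The pairing of [X] with each [Y k] equals the squared norm of [Y k], so the cross terms and the
    norms combine as [- 2 t + t = - t]. *)
Lemma defect_identity :
  \sum_p (X p - \sum_k Y k p) ^+ 2 =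
  n ^+ 2 * ((n - 1) ^+ 2 - t%:R * (m%:R - 1)).
Proof.
have [hF hO] := hS.
have XY : \sum_p X p * (\sum_k Y k p) = t%:R * (n ^+ 2 * (m%:R - 1)).
  under eq_bigr => p _ do rewrite mulr_sumr.
  rewrite exchange_big /=; under eq_bigr => k _ do rewrite corner_dev.
  by rewrite sumr_const card_ord mulr_natl.
have YY : \sum_p (\sum_k Y k p) ^+ 2 = t%:R * (n ^+ 2 * (m%:R - 1)).
  under eq_bigr => p _ do rewrite expr2 big_distrlr.
  rewrite exchange_big /= -[t in RHS]card_ord mulr_natl -sumr_const.
  apply: eq_bigr => k _; rewrite exchange_big (bigD1 k) //=.
  rewrite -[RHS]addr0 -[in RHS](dev_norm (S k i0 i0) (hF k)); congr (_ + _).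
  apply: big1 => k' /negbTE nk.
  by apply: dev_orthogonal => //; apply: hO; rewrite eq_sym nk.
under eq_bigr => p _ do rewrite sqrrB -mulr_natl.
by rewrite big_split sumrB -mulr_sumr /= XY YY corner_norm; ring.
Qed.

End Corner.

Section Bound.
Variables (m l t : nat) (S : 'I_t -> square m l) (i0 : 'I_(m * l)).
Hypothesis hS : is_MOFS S.

Lemma MOFS_bound : t%:R * (m%:R - 1) <= ((m * l)%:R - 1) ^+ 2 :> int.
Proof.
have n0 : 0 < (m * l)%:R :> int by rewrite ltr0n; apply: leq_trans (ltn_ord i0).
rewrite -subr_ge0 -(pmulr_rge0 _ (exprn_gt0 2 n0)) -(defect_identity i0 hS).
by apply: sumr_ge0 => p _; exact: sqr_ge0.
Qed.

Lemma MOFS_tight : t%:R * (m%:R - 1) = ((m * l)%:R - 1) ^+ 2 :> int ->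
  forall i j, \sum_k dev (S k) (S k i0 i0) i j = centred i0 i * centred i0 j.
Proof.
move=> e i j; have := defect_identity i0 hS.
rewrite e subrr mulr0 => /eqP; rewrite psumr_eq0 => [/allP|p _]; last exact: sqr_ge0.
move=> /(_ (i, j)); rewrite mem_index_enum => /(_ isT) /=.
by rewrite expf_eq0 /= subr_eq0 => /eqP.
Qed.

End Bound.

(** A permutation is injective, so an entry is relabelled to the excluded symbol exactly when it
    agrees with the corner; otherwise exactly one indicator is 1. The choice of [s] thus drops
    out. *)
Lemma sum_indicator_relabel m l (S : square m l) (s : 'S_m) (i0 i j : 'I_(m * l)) :
  i0 = 0%N :> nat -> corner_is_1 (relabel s S) ->
  (\sum_(a < m | (0 < a)%N) indicator a (relabel s S)) i j =
  1 - (S i j == S i0 i0)%:R.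
Proof.
move=> h0 /(_ _ _ h0 h0) hc.
have -> : (S i j == S i0 i0) = (relabel s S i j == 0%N :> nat).
  by rewrite -hc !mxE (inj_eq val_inj) (inj_eq perm_inj).
rewrite summxE; under eq_bigr => a _ do rewrite !mxE.
rewrite -big_mkcondr /= mxE; set b := s _.
have [b0|b0] := posnP b.
  by rewrite big_pred0 ?b0 ?subrr // => a; case: eqP => [<-|_]; rewrite ?b0 ?andbF.
rewrite (big_pred1 b) ?subr0 // => a; rewrite [RHS]eq_sym.
by case: eqP => [<-|_]; rewrite ?b0 ?andbF.
Qed.

Theorem theorem9 (m l t : nat) (hm : (2 <= m)%N) (hl : (1 <= l)%N)
    (S : 'I_t -> square m l) (hS : is_MOFS S) :
  t%:R <= ((m * l)%:R - 1) ^+ 2 / (m%:R - 1) :> rat /\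
  forall s : 'I_t -> 'S_m,
    (forall k, corner_is_1 (relabel (s k) (S k))) ->
    (t%:R = ((m * l)%:R - 1) ^+ 2 / (m%:R - 1) :> rat <->
     \sum_(k < t) \sum_(a < m | (0 < a)%N) indicator a (relabel (s k) (S k))
       = extremal_mx m l).
Proof.
have n0 : (0 < m * l)%N by rewrite muln_gt0 hl (ltnW hm).
pose i0 := Ordinal n0.
have m1 : 0 < m%:R - 1 :> rat by rewrite subr_gt0 ltr1n.
have castL : t%:R * (m%:R - 1) = (t%:R * (m%:R - 1) : int)%:~R :> rat.
  by rewrite rmorphM rmorphB /= !rmorph_nat.
have castR : ((m * l)%:R - 1) ^+ 2 = (((m * l)%:R - 1) ^+ 2 : int)%:~R :> rat.
  by rewrite rmorphXn rmorphB /= !rmorph_nat.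
split; first by rewrite ler_pdivlMr // castL castR ler_int (MOFS_bound i0 hS).
move=> s hs.
have -> : (t%:R = ((m * l)%:R - 1) ^+ 2 / (m%:R - 1) :> rat) <->
    t%:R * (m%:R - 1) = ((m * l)%:R - 1) ^+ 2 :> int.
  have m1n : m%:R - 1 != 0 :> rat by rewrite gt_eqF.
  split=> e; last by apply: (mulIf m1n); rewrite divfK // castL castR e.
  by apply/eqP; rewrite -(eqr_int rat) -castL -castR e divfK.
have E i j : (\sum_k \sum_(a < m | (0 < a)%N) indicator a (relabel (s k) (S k))) i j
    = \sum_k (1 - (S k i j == S k i0 i0)%:R).
  by rewrite summxE; apply: eq_bigr => k _; exact: sum_indicator_relabel.
have m0 : m%:R != 0 :> int by rewrite pnatr_eq0 -lt0n (ltnW hm).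
have l0 : l%:R != 0 :> int by rewrite pnatr_eq0 -lt0n.
have eq_i0 (i : 'I_(m * l)) : (i == 0%N :> nat) = (i == i0) by rewrite -val_eqE.
split=> [e|/matrixP e].
  (* Multiplied by [m], each summand becomes [(m - 1) - dev]. *)
  apply/matrixP => i j; rewrite E mxE; apply: (mulfI m0).
  have -> : m%:R * \sum_k (1 - (S k i j == S k i0 i0)%:R) =
      t%:R * (m%:R - 1) - \sum_k dev (S k) (S k i0 i0) i j.
    have -> : t%:R * (m%:R - 1) = \sum_(k < t) (m%:R - 1) :> int.
      by rewrite sumr_const card_ord mulr_natl.
    rewrite mulr_sumr -sumrB.
    by apply: eq_bigr => k _; rewrite /dev; ring.
  (* With [n = m * l], subtracting [(n - 1) ^ 2], [- (n - 1)] or [1] from [(n - 1) ^ 2] gives [0],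
     [n (n - 1)] or [n (n - 2)]. *)
  rewrite (MOFS_tight i0 hS e) e /centred !eq_i0 -(natz l) -(natz (m * l)) natrM.
  by case: (i == i0); case: (j == i0) => /=; ring.
have [hF _] := hS.
(* The factor [1 - (j == i0)] encodes the zero corner of the first row. *)
have : \sum_j \sum_k (1 - (S k i0 j == S k i0 i0)%:R) =
    \sum_j l%:R * ((m * l)%:R - 1) * (1 - (j == i0)%:R) :> int.
  apply: eq_bigr => j _; rewrite -E e mxE !eq_i0 eqxx /= -(natz l) -(natz (m * l)).
  by case: (j == i0) => /=; ring.
rewrite exchange_big /= -mulr_sumr sumrB sumr_const card_ord sum_natr_card.
have -> : [set j | j == i0] = [set i0] by apply/setP => j; rewrite !inE.
under eq_bigr => k _ do
  rewrite sumrB sumr_const card_ord sum_natr_card (proj1 (hF k)).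
rewrite sumr_const card_ord cards1 -[_ *+ t]mulr_natl natrM => e1.
by apply: (mulfI l0); lra.
Qed.
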